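(* Let $(X,\mathcal{U})$ be a quasiuniform space for which there exist a set $U_0\subset X\times X$ containing the diagonal $\Delta=\{(x,x):x\in X\}$ and a base $\mathcal{V}^{*}$ of $\mathcal{U}$ with $U_0\subsetneq U$ for all $U\in\mathcal{V}^{*}$ and $\bigcup\mathcal{V}^{*}=X\times X$, satisfying conditions (Q1)--(Q3) below, where for $x,y\in X$ $$U_{x,y}=\bigcap\{U\in\mathcal{V}^{*}:(x,y)\in U\}\ \text{ if }(x,y)\notin U_0,\qquad U_{x,y}=U_0\ \text{ if }(x,y)\in U_0.$$ (Q1) $\mathcal{V}^{*}=\{U_{x,y}:(x,y)\in (X\times X)\setminus U_0\}$. (Q2) Let $\mathcal{V}=\mathcal{V}^{*}\cup\{U_0\}$ and for $U,V\in\mathcal{V}$ let $U+V$ be the intersection of all sets $W\in\mathcal{V}$ such that $V\circ U\subset W$. Then $\mathcal{V}$ is closed under the operation $+$, and $(\mathcal{V},+)$ is an MVS with neutral element $U_0$. (Q3) For the relation $\unlhd$ on $\mathcal{V}$ induced by $+$ (that is, $U\unlhd V$ iff $U+W=V$ for some $W\in\mathcal{V}$), and all $U,V\in\mathcal{V}$: $U\unlhd V$ if and only if $U\subset V$. Then $X$, with the topology induced by $\mathcal{U}$, is a $\mathcal{V}$-metrizable topological space.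
   Context: A metric value set (MVS) is a set $M$ with at least two elements and a binary operation $+$ such that: (M1) $+$ is associative; (M2) $+$ has a (two-sided) neutral element $e$, and we write $M^{*}=M\setminus\{e\}$; (M3) if $m_1+m_2=e$ then $m_1=m_2=e$; (M4) for all $m_1,m_2\in M^{*}$ there are $m_3\in M^{*}$ and $m_4,m_5\in M$ with $m_1=m_3+m_4$ and $m_2=m_3+m_5$. For $m_1,m_2\in M$ write $m_1\unlhd m_2$ if $m_1+m_3=m_2$ for some $m_3\in M$, and $m_1\lhd m_2$ if $m_1+m_3=m_2$ for some $m_3\in M^{*}$ (so $m\lhd m$ is possible). A quasimetric function is a map $f\colon X\times X\to M$ ($M$ an MVS) with $f(x,x)=e$ for all $x\in X$ and $f(x,z)\unlhd f(x,y)+f(y,z)$ for all $x,y,z\in X$ (no symmetry is required). It induces the topology $\mathcal{T}_f$ on $X$ in which, for every $x\in X$, the balls $B_f(x,m)=\{y\in X: f(x,y)\lhd m\}$, $m\in M^{*}$, form an open neighbourhood base at $x$. A topological space $(X,\mathcal{T})$ is $M$-metrizable if $\mathcal{T}=\mathcal{T}_f$ for some quasimetric function $f\colon X\times X\to M$. For $A,B\subset X\times X$, $A\circ B$ is the set of $(x,z)$ for which there is $y\in X$ with $(x,y)\in B$ and $(y,z)\in A$. A quasiuniformity on $X$ is a non-empty family $\mathcal{U}$ of subsets of $X\times X$, each containing the diagonal, closed under supersets in $X\times X$ and under pairwise intersections, and such that for each $U\in\mathcal{U}$ there is $V\in\mathcal{U}$ with $V\circ V\subset U$; then $(X,\mathcal{U})$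 is a quasiuniform space. A base of $\mathcal{U}$ is a subfamily $\mathcal{B}\subset\mathcal{U}$ such that every $U\in\mathcal{U}$ contains some member of $\mathcal{B}$. The topology induced by $\mathcal{U}$ (equivalently by any base $\mathcal{B}$) is the one for which, for each $x\in X$, the sets $U[x]=\{y\in X:(x,y)\in U\}$, $U\in\mathcal{B}$, form a (not necessarily open) neighbourhood base at $x$. *)

(* Defs.v *)
From HB Require Import structures.
From mathcomp Require Import all_boot.
From mathcomp Require Import boolp classical_sets filter topology.

Set Implicit Arguments.
Unset Strict Implicit.
Unset Printing Implicit Defensive.

Local Open Scope classical_set_scope.
Local Open Scope relation_scope.

(* Metric value sets live on a subset M of an ambient type T, so that families
   of sets (such as subfamilies of set (X * X)) can be used directly; the
   values of add outside M are irrelevant. *)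
Record is_mvs (T : Type) (M : set T) (add : T -> T -> T) (e : T) : Prop := {
  mvs_closed : forall a b, M a -> M b -> M (add a b);
  mvs_two : exists a b, [/\ M a, M b & a <> b];
  mvs_assoc : forall a b c, M a -> M b -> M c ->
    add (add a b) c = add a (add b c);
  mvs_neutral_in : M e;
  mvs_neutral : forall a, M a -> add e a = a /\ add a e = a;
  mvs_positive : forall a b, M a -> M b -> add a b = e -> a = e /\ b = e;
  mvs_refine : forall m1 m2, (M `\ e) m1 -> (M `\ e) m2 ->
    exists m3 m4 m5, [/\ (M `\ e) m3, M m4, M m5,
                         m1 = add m3 m4 & m2 = add m3 m5]
}.

Section MetricValueSets.
Context (T : Type) (M : set T) (add : T -> T -> T) (e : T).

Definition mvs_le (m1 m2 : T) : Prop := exists2 m3, M m3 & add m1 m3 = m2.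

(* Strictness refers to the increment: mvs_lt m m is possible. *)
Definition mvs_lt (m1 m2 : T) : Prop :=
  exists2 m3, (M `\ e) m3 & add m1 m3 = m2.

Record is_quasimetric (X : Type) (f : X -> X -> T) : Prop := {
  quasimetric_val : forall x y, M (f x y);
  quasimetric_refl : forall x, f x x = e;
  quasimetric_triangle : forall x y z, mvs_le (f x z) (add (f x y) (f y z))
}.

Definition qball (X : Type) (f : X -> X -> T) (x : X) (m : T) : set X :=
  [set y | mvs_lt (f x y) m].

(* The topology of X is the one in which, at every point, the balls form an
   open neighbourhood base. *)
Definition induces_topology (X : topologicalType) (f : X -> X -> T) : Prop :=
  forall x : X,
    (forall m, (M `\ e) m -> open_nbhs x (qball f x m)) /\
    (forall A, nbhs x A -> exists2 m, (M `\ e) m & qball f x m `<=` A).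

Definition metrizable (X : topologicalType) : Prop :=
  exists f : X -> X -> T, is_quasimetric f /\ induces_topology f.

End MetricValueSets.

Section QuasiUniformities.
Context (X : Type).
Implicit Types U V W : set (X * X).
Implicit Types F B : set (set (X * X)).

(* For relations, V \; U relates x to z when (x, y) in U and (y, z) in V for
   some y: U is applied first, so this is V o U. *)
Record quasiuniformity F : Prop := {
  quasiunif_nonempty : F !=set0;
  quasiunif_diag : forall U, F U -> diagonal `<=` U;
  quasiunif_superset : forall U V, F U -> U `<=` V -> F V;
  quasiunif_setI : forall U V, F U -> F V -> F (U `&` V);
  quasiunif_split : forall U, F U -> exists2 V, F V & V \; V `<=` U
}.

Definition quasiunif_base F B : Prop :=
  B `<=` F /\ forall U, F U -> exists2 V, B V & V `<=` U.

Definition unif_hull (U0 : set (X * X)) B (x y : X) : set (X * X) :=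
  if (x, y) \in U0 then U0 else \bigcap_(U in [set U | B U /\ U (x, y)]) U.

(* Empty intersections are the whole of X * X. *)
Definition unif_add F U V : set (X * X) :=
  \bigcap_(W in [set W | F W /\ V \; U `<=` W]) W.

End QuasiUniformities.

(* The carrier X equipped with the topology induced by the quasiuniformity F. *)
Definition quspace (X : Type) (F : set (set (X * X)))
  (hF : quasiuniformity F) : Type := X.

Section QuasiUniformTopology.
Context (X : Type) (F : set (set (X * X))) (hF : quasiuniformity F).

HB.instance Definition _ := gen_eqMixin (quspace hF).
HB.instance Definition _ := gen_choiceMixin (quspace hF).

Definition quspace_nbhs (x : quspace hF) : set_system (quspace hF) :=
  filter_from F (fun U => xsection U x).

HB.instance Definition _ := hasNbhs.Build (quspace hF) quspace_nbhs.

Lemma quspace_nbhs_filter (x : quspace hF) : ProperFilter (nbhs x).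
Proof.
apply: filter_from_proper; last first.
  by move=> U FU; exists x; apply/xsectionP; exact: (quasiunif_diag hF FU).
apply: filter_from_filter.
  by have [U FU] := quasiunif_nonempty hF; exists U.
move=> U V FU FV; exists (U `&` V); first exact: quasiunif_setI.
by move=> y /xsectionP[Uy Vy]; split; apply/xsectionP.
Qed.

Lemma quspace_nbhs_singleton (x : quspace hF) (A : set (quspace hF)) :
  nbhs x A -> A x.
Proof.
by move=> [U FU UA]; apply: UA; apply/xsectionP; exact: (quasiunif_diag hF FU).
Qed.

Lemma quspace_nbhs_nbhs (x : quspace hF) (A : set (quspace hF)) :
  nbhs x A -> nbhs x (nbhs^~ A).
Proof.
move=> [U FU UA]; have [V FV VVU] := quasiunif_split hF FU.
exists V => // y /xsectionP Vxy; exists V => // z /xsectionP Vyz.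
by apply: UA; apply/xsectionP; apply: VVU; exists y.
Qed.

HB.instance Definition _ := Nbhs_isNbhsTopological.Build (quspace hF)
  quspace_nbhs_filter quspace_nbhs_singleton quspace_nbhs_nbhs.

End QuasiUniformTopology.

(* Main.v *)
Require Import Defs.
From mathcomp Require Import all_boot.
From mathcomp Require Import boolp classical_sets filter topology.

(** The quasimetric is [f x y = unif_hull U0 Vs x y], the least member of
    [V = Vs `|` [set U0]] containing [(x, y)]; so [f x y `<=` W] holds exactly
    when [W] contains [(x, y)] ([unif_hull_sub], [unif_hull_mem]).

    The triangle inequality holds because [(x, z)] lies in the composite of
    [f x y] and [f y z], hence in the member [f x y + f y z] of [V], and
    inclusion of members of [V] is the order of the metric value set.

    For the topology, the axioms of a metric value set make every ball around
    [x] contain a ball around each of its points ([qball_center]).  So balls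
    are open as soon as each is a neighbourhood of its own centre
    ([induces_topology_of_nbhs]), that is, as soon as each [m] in [Vs] has a
    [U] in [Vs] with [U] strictly below [m] ([unif_lt_exists]): the ball then
    contains the section of [U] at [x].  Such a [U] comes from splitting: a
    [U] with [U o U `<=` m] satisfies [U + U <= m], and [U] is not the neutral
    element, so the increment from [U] to [m] is not neutral either.
    Conversely the ball of radius [m] at [x] is contained in the section of
    [m] at [x], so balls are arbitrarily small. *)

Set Implicit Arguments.
Unset Strict Implicit.
Unset Printing Implicit Defensive.

Local Open Scope classical_set_scope.

Section MetricValueSetTheory.
Context (T : Type) (M : set T) (add : T -> T -> T) (e : T).
Context (hM : is_mvs M add e).

Lemma mvs_addl_neq a b : M a -> (M `\ e) b -> (M `\ e) (add a b).
Proof.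
move=> Ma [Mb be]; split; first exact: (mvs_closed hM).
by move=> /(mvs_positive hM Ma Mb)[_ /be].
Qed.

Lemma mvs_addr_neq a b : (M `\ e) a -> M b -> (M `\ e) (add a b).
Proof.
move=> [Ma ae] Mb; split; first exact: (mvs_closed hM).
by move=> /(mvs_positive hM Ma Mb)[/ae].
Qed.

Lemma mvs_le_lt_trans a b c : M a ->
  mvs_le M add a b -> mvs_lt M add e b c -> mvs_lt M add e a c.
Proof.
move=> Ma [s Ms <-] [t Mt <-]; exists (add s t); first exact: mvs_addl_neq.
by rewrite (mvs_assoc hM) //; case: Mt.
Qed.

(** The strict increment from [f x y] to [m] serves as the radius [n]:
    if [f y z + r = n] then [f x z <= f x y + f y z] and
    [f x y + f y z + r = m]. *)
Lemma qball_center (X : Type) (f : X -> X -> T) (x y : X) (m : T) :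
  is_quasimetric M add e f -> qball M add e f x m y ->
  exists2 n, (M `\ e) n & qball M add e f y n `<=` qball M add e f x m.
Proof.
move=> hf [n Mn <-]; exists n => // z [r Mr <-].
have Mf := quasimetric_val hf.
apply: mvs_le_lt_trans (quasimetric_triangle hf x y z) _ => //.
by exists r => //; rewrite (mvs_assoc hM) //; case: Mr.
Qed.

Lemma induces_topology_of_nbhs (X : topologicalType) (f : X -> X -> T) :
  is_quasimetric M add e f ->
  (forall x m, (M `\ e) m -> nbhs x (qball M add e f x m)) ->
  (forall (x : X) A, nbhs x A ->
     exists2 m, (M `\ e) m & qball M add e f x m `<=` A) ->
  induces_topology M add e f.
Proof.
move=> hf nbhs_ball ball_nbhs x; split; last exact: ball_nbhs.
move=> m Mm; rewrite open_nbhsE; split; last exact: nbhs_ball.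
rewrite openE => y /(qball_center hf)[n Mn] sub_ball; apply: (filterS sub_ball).
exact: (nbhs_ball _ _ Mn).
Qed.

End MetricValueSetTheory.

Section Hull.
Context (X : Type) (U0 : set (X * X)) (Vs : set (set (X * X))).
Local Notation V := (Vs `|` [set U0]).

Lemma unif_hull_mem x y : unif_hull U0 Vs x y (x, y).
Proof.
by rewrite /unif_hull; case: ifPn => [/set_mem //|_ U []].
Qed.

Lemma unif_hull_sub W x y : (forall U, Vs U -> U0 `<=` U) ->
  V W -> W (x, y) -> unif_hull U0 Vs x y `<=` W.
Proof.
move=> hsub VW Wxy; rewrite /unif_hull; case: ifPn => [_|/negP nU0].
  by case: VW => [/hsub //|->].
case: VW => [VsW|W0]; first by move=> p; apply.
by case: nU0; rewrite -W0; exact/mem_set.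
Qed.

Lemma unif_hull_in :
  Vs = [set W | exists x y, ~ U0 (x, y) /\ W = unif_hull U0 Vs x y] ->
  forall x y, V (unif_hull U0 Vs x y).
Proof.
move=> Q1 x y; have [U0xy|nU0] := pselect (U0 (x, y)).
  by right; rewrite /unif_hull mem_set.
by left; rewrite {1}Q1; exists x, y.
Qed.

End Hull.

Lemma unif_add_comp (X : Type) (F : set (set (X * X))) U W (x y z : X) :
  U (x, y) -> W (y, z) -> unif_add F U W (x, z).
Proof. by move=> Uxy Wyz S [_]; apply; exists y. Qed.

(** If [U o U `<=` m] then [U + U + s = m] for some [s], and the increment
    [U + s] from [U] to [m] differs from [U0] because [U] does. *)
Lemma unif_lt_exists (X : Type) (F Vs : set (set (X * X))) (U0 : set (X * X)) :
  let V := Vs `|` [set U0] in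
  quasiuniformity F -> quasiunif_base F Vs -> ~ Vs U0 ->
  is_mvs V (unif_add V) U0 ->
  (forall U W, V U -> V W -> U `<=` W -> mvs_le V (unif_add V) U W) ->
  forall m, Vs m -> exists2 U, Vs U & mvs_lt V (unif_add V) U0 U m.
Proof.
move=> V hF [VsF baseF] nVsU0 hV hle m Vsm.
have [W FW WWm] := quasiunif_split hF (VsF _ Vsm).
have [U VsU UW] := baseF _ FW.
have VU : V U by left.
have VU0 : (V `\ U0) U by split=> // UU0; apply: nVsU0; rewrite -UU0.
have UUm : unif_add V U U `<=` m.
  move=> p; apply; split; first by left.
  by move=> [x z] [y /= Uxy Uyz]; apply: WWm; exists y; exact: UW.
have [|s Vs_s <-] := hle _ m (mvs_closed hV VU VU) _ UUm; first by left.
exists U => //; exists (unif_add V U s); first exact: (mvs_addr_neq hV).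
by rewrite (mvs_assoc hV).
Qed.

Theorem theorem2p14 (X : Type) (F : set (set (X * X)))
  (hF : quasiuniformity F)
  (U0 : set (X * X)) (Vs : set (set (X * X)))
  (hU0 : diagonal `<=` U0)
  (hbase : quasiunif_base F Vs)
  (hproper : forall U, Vs U -> U0 `<` U)
  (hcover : \bigcup_(U in Vs) U = setT)
  (Q1 : Vs = [set W | exists x y, ~ U0 (x, y) /\ W = unif_hull U0 Vs x y])
  (Q2 : let V := Vs `|` [set U0] in is_mvs V (unif_add V) U0)
  (Q3 : let V := Vs `|` [set U0] in
     forall U W, V U -> V W -> (mvs_le V (unif_add V) U W <-> U `<=` W)) :
  let V := Vs `|` [set U0] in
  metrizable V (unif_add V) U0 (quspace hF).
Proof.
move=> V; rewrite -/V in Q2; rewrite /= -/V in Q3.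
have hsub U : Vs U -> U0 `<=` U by move=> /hproper/properW.
have nVsU0 : ~ Vs U0 by move=> /hproper /properxx.
have VsE m : (V `\ U0) m <-> Vs m.
  split=> [[[//|mU0] /(_ mU0)//]|Vsm]; split; first by left.
  by move=> mU0; apply: nVsU0; rewrite -mU0.
have leS U W (VU : V U) (VW : V W) := Q3 U W VU VW.
pose f : quspace hF -> quspace hF -> set (X * X) := unif_hull U0 Vs.
have Vf x y : V (f x y) := unif_hull_in Q1 x y.
have hull_le x y W : V W -> W (x, y) -> mvs_le V (unif_add V) (f x y) W.
  by move=> VW Wxy; apply/leS => //; exact: unif_hull_sub.
have hf : is_quasimetric V (unif_add V) U0 f.
  split=> // [x|x y z]; first by rewrite /f /unif_hull mem_set //; exact: hU0.
  apply: hull_le; first exact: (mvs_closed Q2).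
  by apply: unif_add_comp; exact: unif_hull_mem.
exists f; split=> //; apply: (induces_topology_of_nbhs Q2) => //.
- move=> x m /VsE Vsm.
  have [|U VsU Um] := unif_lt_exists hF hbase nVsU0 Q2 _ Vsm.
    by move=> U W VU VW /leS; apply.
  exists U; first exact: hbase.1.
  move=> y /xsectionP Uxy.
  apply: (mvs_le_lt_trans Q2) Um => //.
  by apply: hull_le => //; left.
- move=> x A [U FU UA]; have [m Vsm mU] := hbase.2 _ FU.
  exists m; first exact/VsE.
  move=> y [r [Vr _] fxyr]; apply: UA; apply/xsectionP; apply: mU.
  have /leS : mvs_le V (unif_add V) (f x y) m by exists r.
  by apply=> //; [left | exact: unif_hull_mem].
Qed.
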